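(* Let $\mathcal V$ be a finite set with $|\mathcal V|\ge 2$, let $\epsilon\ge0$, let $\mathbf w=\{w_j\}_{j\in\mathcal V}$ be a family of vectors in $\mathbb R^d$, let $h\in\mathbb R^d$ and let $i\in\mathcal V$. Then $$\mathrm{AdvSoft}_\epsilon(i,\mathbf w,h)\le\sigma\big(\Phi(i,\mathbf w,\|h\|)\big),$$ where $\sigma(t)=1/(1+\exp(-t))$ is the sigmoid function and, for $\alpha\in\mathbb R$, $$\Phi(i,\mathbf w,\alpha)=-\log\sum_{j\ne i}\exp\big(-\alpha(\|w_i-w_j\|-\epsilon)\big).$$ Moreover, this function satisfies $$\Phi(i,\mathbf w,\alpha)\le\alpha\min_{j\neq i}\big(\|w_i-w_j\|-\epsilon\big).$$
   Context: $\|\cdot\|$ denotes the Euclidean norm. For a family $\mathbf w=\{w_j\}_{j\in\mathcal V}\subset\mathbb R^d$, $i\in\mathcal V$ and $h\in\mathbb R^d$, $\mathrm{Softmax}(i,\mathbf w,h)=\exp(w_i^\top h)/\sum_{\ell\in\mathcal V}\exp(w_\ell^\top h)$. The adversarial softmax is $$\mathrm{AdvSoft}_\epsilon(i,\mathbf w,h):=\min_{\|\delta_i\|\le\epsilon}\mathrm{Softmax}(i,\{w_i+\delta_i,\,w_{\neg i}\},h)=\frac{\exp(w_i^\top h-\epsilon\|h\|)}{\exp(w_i^\top h-\epsilon\|h\|)+\sum_{j\ne i}\exp(w_j^\top h)},$$ where $w_{\neg i}=\{w_j:j\ne i\}$ and $\{w_i+\delta_i,w_{\neg i}\}$ is the family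 $\mathbf w$ with $w_i$ replaced by $w_i+\delta_i$. *)

(* Defs.v *)
From mathcomp Require Import all_boot all_order all_algebra.
From mathcomp Require Import all_classical all_reals all_analysis.

Set Implicit Arguments.
Unset Strict Implicit.
Unset Printing Implicit Defensive.

Import Order.TTheory GRing.Theory Num.Theory.

Local Open Scope classical_set_scope.
Local Open Scope ring_scope.

(* u^T v in R^d *)
Definition dotv (R : realType) (d : nat) (u v : 'cV[R]_d) : R :=
  (u^T *m v) ord0 ord0.

(* The norm that MathComp-Analysis puts on matrices is the sup norm, hence a
   separate Euclidean norm. *)
Definition enorm (R : realType) (d : nat) (v : 'cV[R]_d) : R :=
  Num.sqrt (\sum_(k < d) v k ord0 ^+ 2).

Definition Softmax (R : realType) (V : finType) (d : nat)
    (i : V) (w : V -> 'cV[R]_d) (h : 'cV[R]_d) : R :=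
  expR (dotv (w i) h) / \sum_(l : V) expR (dotv (w l) h).

(* For 0 <= eps this infimum is a minimum: a continuous function on a nonempty
   compact ball, minimal at delta = - eps h / ||h|| when h != 0. *)
Definition AdvSoft (R : realType) (V : finType) (d : nat) (eps : R)
    (i : V) (w : V -> 'cV[R]_d) (h : 'cV[R]_d) : R :=
  inf [set Softmax i [eta w with i |-> w i + delta] h
      | delta in [set delta : 'cV[R]_d | enorm delta <= eps]].

Definition sigmoid (R : realType) (t : R) : R := 1 / (1 + expR (- t)).

Definition Phi (R : realType) (V : finType) (d : nat) (eps : R)
    (i : V) (w : V -> 'cV[R]_d) (alpha : R) : R :=
  - ln (\sum_(j : V | j != i) expR (- alpha * (enorm (w i - w j) - eps))).

(* The infimum of a finite set of reals, nonempty as soon as 1 < #|V|, hence a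
   minimum. *)
Definition min_margin (R : realType) (V : finType) (d : nat) (eps : R)
    (i : V) (w : V -> 'cV[R]_d) : R :=
  inf [set enorm (w i - w j) - eps | j in [set j : V | j != i]].

(* Main.v *)
(* The minimum defining AdvSoft is at most the softmax at the perturbation
   -eps h / ||h||, namely 1 / (1 + sum_j exp ((w_j - w_i)^T h + eps ||h||)), and
   Cauchy-Schwarz bounds each exponent below by -||h|| (||w_i - w_j|| - eps).
   The bound on Phi keeps the single term of the sum at a minimizing j. *)
Require Import Defs.
From mathcomp Require Import all_boot all_order all_algebra.
From mathcomp Require Import all_classical all_reals all_analysis.
From mathcomp Require Import ring lra.

Set Implicit Arguments.
Unset Strict Implicit.
Unset Printing Implicit Defensive.

Import Order.TTheory GRing.Theory Num.Theory.

Local Open Scope ring_scope.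

Section EuclideanNorm.
Variables (R : realType) (d : nat).
Implicit Types (u v h : 'cV[R]_d) (a : R).

Lemma dotvE u v : dotv u v = \sum_k u k ord0 * v k ord0.
Proof. by rewrite /dotv mxE; apply: eq_bigr => k _; rewrite mxE. Qed.

Lemma dotvDl u v h : dotv (u + v) h = dotv u h + dotv v h.
Proof. by rewrite /dotv linearD /= mulmxDl mxE. Qed.

Lemma dotvBl u v h : dotv (u - v) h = dotv u h - dotv v h.
Proof. by rewrite /dotv linearB /= mulmxBl !mxE. Qed.

Lemma dotvZl a u h : dotv (a *: u) h = a * dotv u h.
Proof. by rewrite /dotv linearZ /= -scalemxAl mxE. Qed.

Lemma enorm_ge0 v : 0 <= enorm v.
Proof. exact: sqrtr_ge0. Qed.

Lemma enorm_sqr v : enorm v ^+ 2 = \sum_k v k ord0 ^+ 2.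
Proof. by rewrite sqr_sqrtr // sumr_ge0 // => k _; rewrite sqr_ge0. Qed.

Lemma dotvv v : dotv v v = enorm v ^+ 2.
Proof. by rewrite dotvE enorm_sqr; apply: eq_bigr => k _; rewrite expr2. Qed.

Lemma enormZ a v : enorm (a *: v) = `|a| * enorm v.
Proof.
rewrite /enorm -sqrtr_sqr -sqrtrM ?sqr_ge0 // mulr_sumr.
by congr Num.sqrt; apply: eq_bigr => k _; rewrite mxE exprMn.
Qed.

Lemma enorm0_eq0 v : enorm v = 0 -> v = 0.
Proof.
move=> v0; have := enorm_sqr v; rewrite v0 expr0n /= => /esym/eqP.
rewrite psumr_eq0 => [/allP v0'|k _]; last exact: sqr_ge0.
apply/matrixP => k j; rewrite (ord1 j) mxE.
by have := v0' k (mem_index_enum k); rewrite /= sqrf_eq0 => /eqP.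
Qed.

(** Cauchy-Schwarz: with [a], [b] the norms of [u], [v], expanding the sum of the squares
    [(b * u_k - a * v_k) ^+ 2] gives [2ab (ab - dotv u v)]. Dividing by [ab] requires both norms to
    be nonzero, so a zero vector is treated first. *)
Lemma dotv_le_enorm u v : dotv u v <= enorm u * enorm v.
Proof.
set a := enorm u; set b := enorm v.
have [u0|u_neq0] := eqVneq a 0.
  by rewrite (enorm0_eq0 u0) u0 mul0r /dotv trmx0 mul0mx mxE.
have [v0|v_neq0] := eqVneq b 0.
  by rewrite (enorm0_eq0 v0) v0 mulr0 /dotv mulmx0 mxE.
have ab_gt0 : 0 < a * b by rewrite mulr_gt0 // lt0r ?u_neq0 ?v_neq0 enorm_ge0.
have : 0 <= \sum_k (b * u k ord0 - a * v k ord0) ^+ 2.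
  by apply: sumr_ge0 => k _; exact: sqr_ge0.
have -> : \sum_k (b * u k ord0 - a * v k ord0) ^+ 2 =
    (a * b) * ((a * b - dotv u v) *+ 2).
  transitivity (b ^+ 2 * dotv u u - (a * b *+ 2) * dotv u v + a ^+ 2 * dotv v v).
    rewrite !dotvE !mulr_sumr -sumrN -!big_split /=.
    by apply: eq_bigr => k _; ring.
  by rewrite !dotvv -/a -/b; ring.
by rewrite pmulr_rge0 // pmulrn_lge0 // subr_ge0.
Qed.

End EuclideanNorm.

Lemma exists_neq (T : finType) (x : T) : (2 <= #|T|)%N -> exists y, y != x.
Proof.
move=> /card_gt1P[y [z [_ _ yz]]].
by have [yx|] := eqVneq y x; [exists z; rewrite -yx eq_sym | exists y].
Qed.

Section Softmax.
Variables (R : realType) (V : finType) (d : nat).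
Implicit Types (w : V -> 'cV[R]_d) (i : V) (h delta : 'cV[R]_d) (eps : R).

Lemma Softmax_ge0 i w h : 0 <= Softmax i w h.
Proof. by rewrite divr_ge0 ?expR_ge0 ?sumr_ge0 // => j _; exact: expR_ge0. Qed.

(** Divide numerator and denominator by the numerator. Since only [w i] moves, [delta] enters every
    remaining term through the same shift [- dotv delta h]. *)
Lemma Softmax_perturbE i w h delta :
  Softmax i [eta w with i |-> w i + delta] h =
  (1 + \sum_(j | j != i) expR (dotv (w j - w i) h - dotv delta h))^-1.
Proof.
rewrite /Softmax (bigD1 i) //= eqxx dotvDl.
set t := dotv (w i) h + dotv delta h.
rewrite -[LHS]invf_div; congr (_^-1).
rewrite mulrDl divff ?gt_eqF ?expR_gt0 // mulr_suml; congr (_ + _).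
apply: eq_bigr => j /negbTE -> /=.
by rewrite -expRN -expRD dotvBl /t opprD addrA.
Qed.

Lemma AdvSoft_le_Softmax eps i w h delta : enorm delta <= eps ->
  AdvSoft eps i w h <= Softmax i [eta w with i |-> w i + delta] h.
Proof.
move=> le_delta; apply: ge_inf; last by exists delta.
(* [inf] is a lower bound only of sets bounded below; here 0 is such a bound. *)
by exists 0 => _ [delta' _ <-]; exact: Softmax_ge0.
Qed.

(** Brings the sigmoid of [Phi] to the shape of [Softmax_perturbE], so that only two sums remain to
    be compared. *)
Lemma sigmoidN_ln (x : R) : 0 < x -> sigmoid (- ln x) = (1 + x)^-1.
Proof. by move=> x0; rewrite /sigmoid opprK lnK ?posrE // div1r. Qed.

Lemma sum_expR_gt0 i (f : V -> R) : (2 <= #|V|)%N ->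
  0 < \sum_(j | j != i) expR (f j).
Proof.
move=> /(exists_neq i)[j ji].
by rewrite (bigD1 j) //= ltr_pwDl ?expR_gt0 ?sumr_ge0.
Qed.

Lemma AdvSoft_le_sigmoid_Phi eps i w h : (2 <= #|V|)%N -> 0 <= eps ->
  AdvSoft eps i w h <= sigmoid (Phi eps i w (enorm h)).
Proof.
move=> hV eps0.
(* For [h = 0] the junk value [0^-1 = 0] makes this perturbation zero. *)
pose delta := - (eps / enorm h) *: h.
have delta_le : enorm delta <= eps.
  rewrite enormZ normrN ger0_norm ?divr_ge0 ?enorm_ge0 //.
  have [->|h0] := eqVneq (enorm h) 0; first by rewrite mulr0.
  by rewrite divfK.
have delta_h : dotv delta h = - (eps * enorm h).
  rewrite dotvZl dotvv mulNr; congr (- _).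
  have [->|h0] := eqVneq (enorm h) 0; first by rewrite expr0n !mulr0.
  by rewrite expr2 mulrA divfK.
apply: le_trans (AdvSoft_le_Softmax i w h delta_le) _.
rewrite Softmax_perturbE /Phi sigmoidN_ln ?sum_expR_gt0 //.
(* Inversion reverses the order: the sum from [Phi] must be at most the softmax sum, which is
   checked term by term. *)
rewrite lef_pV2 ?posrE ?addr_gt0 ?sum_expR_gt0 // lerD2l.
apply: ler_sum => j _; rewrite ler_expR delta_h.
have := dotv_le_enorm (w i - w j) h; rewrite !dotvBl.
by lra.
Qed.

(** An argmin over the indices other than [i], nonempty by the cardinality bound, gives a value that
    is both a member and a lower bound of the set. *)
Lemma min_margin_attained eps i w : (2 <= #|V|)%N ->
  exists2 j, j != i & min_margin eps i w = enorm (w i - w j) - eps.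
Proof.
move=> /(exists_neq i)[j0 j0i].
pose m j := enorm (w i - w j) - eps.
case: (arg_minP (P := fun j => j != i) m j0i) => j ji le_j; exists j => //.
apply/eqP; rewrite eq_le; apply/andP; split.
  apply: ge_inf; last by exists j.
  by exists (m j) => _ [k ki <-]; exact: le_j.
apply: lb_le_inf; first by exists (m j); exists j.
by move=> _ [k ki <-]; exact: le_j.
Qed.

Lemma Phi_le_margin eps i w (alpha : R) j : j != i ->
  Phi eps i w alpha <= alpha * (enorm (w i - w j) - eps).
Proof.
move=> ji; rewrite /Phi lerNl -mulNr -[leLHS]expRK.
rewrite (bigD1 j) //= ler_ln ?posrE ?ltr_pwDl ?expR_gt0 ?sumr_ge0 //.
by rewrite lerDl sumr_ge0.
Qed.

End Softmax.

Theorem theorem3p4 (R : realType) (V : finType) (hV : (2 <= #|V|)%N)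
    (eps : R) (heps : 0 <= eps) (d : nat) (w : V -> 'cV[R]_d)
    (h : 'cV[R]_d) (i : V) :
  AdvSoft eps i w h <= sigmoid (Phi eps i w (enorm h)) /\
  (forall alpha : R, Phi eps i w alpha <= alpha * min_margin eps i w).
Proof.
split=> [|alpha]; first exact: AdvSoft_le_sigmoid_Phi.
(* Evaluating at one attaining index makes the argument independent of the sign of [alpha]. *)
by have [j ji ->] := min_margin_attained eps i w hV; exact: Phi_le_margin.
Qed.
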